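(* Let $G$ be a digraph, $b\in V(G)$ and $I\subseteq V(G)\setminus\{b\}$. There is a domination linkage from $I$ to $\{b\}$ if and only if every finite subset of $I$ has a linkage into $b$.
   Context: Paths are finite directed paths; ''disjoint'' means edge-disjoint. A directed ray $R$ dominates $b$ if there are infinitely many edge-disjoint directed paths from vertices of $R$ to $b$; a vertex $v$ dominates $b$ if there are infinitely many edge-disjoint directed $v$–$b$ paths; a path dominates $b$ if its last vertex dominates $b$. A domination linkage from $I$ to $\{b\}$ is a family $(Q_a\mid a\in I)$ of pairwise edge-disjoint directed paths or rays such that $Q_a$ starts at $a$ and either ends at $b$ or dominates $b$. A finite set $S$ has a linkage into $b$ if there are pairwise edge-disjoint directed paths $(P_s\mid s\in S)$ with $P_s$ from $s$ to $b$. *)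

(* Defs.v *)
From Stdlib Require List.
From mathcomp Require Import all_boot.
From mathcomp Require Import boolp classical_sets functions cardinality.

Set Implicit Arguments.
Unset Strict Implicit.
Unset Printing Implicit Defensive.

Local Open Scope classical_set_scope.

(* Infinitely many vertices and edges, parallel edges and loops are allowed. *)
Record digraph := Digraph {
  vertex : Type;
  edge : Type;
  init : edge -> vertex;
  ter : edge -> vertex
}.

Arguments init {G} : rename.
Arguments ter {G} : rename.

Section Paths.
Variable G : digraph.
Implicit Types (u v b : vertex G) (es : seq (edge G)).

Fixpoint chain u es : Prop :=
  if es is e :: es' then init e = u /\ chain (ter e) es' else True.

(* The vertices traversed are [path_start] followed by the terminal vertices
   of the edges. A path with no edge is the trivial path at [path_start];
   recording the start makes trivial paths at distinct vertices distinct. *)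
Record dipath := DiPath {
  path_start : vertex G;
  path_seq : seq (edge G);
  path_chain : chain path_start path_seq;
  path_simple : List.NoDup (path_start :: map ter path_seq)
}.

Definition path_end (p : dipath) : vertex G :=
  last (path_start p) (map ter (path_seq p)).

Definition path_edges (p : dipath) : set (edge G) :=
  [set e | List.In e (path_seq p)].

Record diray := DiRay {
  ray_vertex : nat -> vertex G;
  ray_edge : nat -> edge G;
  ray_init : forall n, init (ray_edge n) = ray_vertex n;
  ray_ter : forall n, ter (ray_edge n) = ray_vertex n.+1;
  ray_simple : injective ray_vertex
}.

(* The paths form an infinite set, not merely an infinite family: a trivial
   path is edge-disjoint from itself and must not be counted repeatedly. *)
Definition inf_disjoint_paths (A : set (vertex G)) b : Prop :=
  exists P : set dipath,
    [/\ infinite_set P,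
        trivIset P path_edges &
        forall p, P p -> A (path_start p) /\ path_end p = b].

Definition vertex_dominates v b : Prop := inf_disjoint_paths [set v] b.

Definition path_dominates (p : dipath) b : Prop :=
  vertex_dominates (path_end p) b.

Definition ray_dominates (r : diray) b : Prop :=
  inf_disjoint_paths (range (ray_vertex r)) b.

Inductive path_or_ray := IsPath of dipath | IsRay of diray.

Definition start (q : path_or_ray) : vertex G :=
  match q with IsPath p => path_start p | IsRay r => ray_vertex r 0 end.

Definition edges (q : path_or_ray) : set (edge G) :=
  match q with IsPath p => path_edges p | IsRay r => range (ray_edge r) end.

Definition ends_at (q : path_or_ray) b : Prop :=
  match q with IsPath p => path_end p = b | IsRay _ => False end.

Definition dominates (q : path_or_ray) b : Prop :=
  match q with IsPath p => path_dominates p b | IsRay r => ray_dominates r b end.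

(* Families indexed by a set of vertices are total functions on the vertices
   whose values outside the index set are irrelevant. *)
Definition domination_linkage (I : set (vertex G)) b
    (Q : vertex G -> path_or_ray) : Prop :=
  trivIset I (fun a => edges (Q a)) /\
  forall a, I a -> start (Q a) = a /\ (ends_at (Q a) b \/ dominates (Q a) b).

Definition has_linkage (S : set (vertex G)) b : Prop :=
  exists P : vertex G -> dipath,
    trivIset S (fun s => path_edges (P s)) /\
    forall s, S s -> path_start (P s) = s /\ path_end (P s) = b.

End Paths.

(* Main.v *)
(* Call [X] a cut if it avoids [b] and only finitely many edges leave it. A set
   of vertices contained in no cut sends infinitely many edge-disjoint paths to
   [b], so a vertex in no cut is as good a target as [b] itself. If [Q] is a
   domination linkage, every member of [Q] starting in a cut leaves it, and the
   linkages of finite sets follow from Menger's theorem.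

   Conversely, call [U] good if for every cut [X] the sources in [X \ U] and the
   edges from [U] to [X \ U] are together at most as many as the edges leaving
   [U u X] from [X \ U]. The empty set is good by hypothesis, unions of chains
   of good sets are good, and a good [U] stays good when one adds a cut [X]
   minimising the surplus of outgoing edges. Transfinite iteration partitions
   the vertices lying in cuts into layers. By Menger's theorem, inside each
   layer all sources and all edges entering from lower layers are linked to
   distinct edges leaving for higher layers or for vertices in no cut.
   Concatenating these links from a source gives a path to a vertex in no cut,
   or a ray through infinitely many layers. Such a ray lies in no cut [X]: its
   layers exhaust a good set [U], the finitely many edges leaving [X n U] start
   below some layer, above which [X n U] then has no outgoing edge, hence by
   goodness no incoming one, although the ray enters it. *)
From HB Require Import structures.
Require Import Defs.
From Stdlib Require List.
From mathcomp Require Import all_boot finmap.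
From mathcomp Require Import boolp classical_sets functions cardinality.
From mathcomp Require wochoice.
From mathcomp Require Import zify.

Set Implicit Arguments.
Unset Strict Implicit.
Unset Printing Implicit Defensive.

Local Open Scope classical_set_scope.

(** * Classical equality, choice and counting in lists *)

HB.instance Definition _ (G : digraph) := gen_eqMixin (vertex G).
HB.instance Definition _ (G : digraph) := gen_choiceMixin (vertex G).
HB.instance Definition _ (G : digraph) := gen_eqMixin (edge G).
HB.instance Definition _ (G : digraph) := gen_choiceMixin (edge G).

Lemma InP (T : eqType) (x : T) s : reflect (List.In x s) (x \in s).
Proof.
elim: s => [|y s IHs] /=; first by rewrite in_nil; constructor.
rewrite inE eq_sym; apply: (iffP orP) => -[].
- by move/eqP; left.
- by move/IHs; right.
- by move=> ->; left.
- by move/IHs; right.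
Qed.

Lemma NoDupP (T : eqType) (s : seq T) : reflect (List.NoDup s) (uniq s).
Proof.
elim: s => [|y s IHs] /=; first by do 2!constructor.
apply: (iffP andP) => [[ys /IHs us]|h].
  by constructor => // /InP; apply/negP.
inversion h as [|? ? ys us]; subst; split; last exact/IHs.
by apply/negP => /InP.
Qed.

(** Turns a conservation law known vertex by vertex into one for a whole set [R]. *)
Lemma count_fibers (T U : eqType) (f : T -> U) (R : pred U) (s : seq T)
    (L : seq U) : uniq L -> (forall x, x \in s -> f x \in L) ->
  count (fun x => R (f x)) s =
  \sum_(v <- L | R v) count (fun x => f x == v) s.
Proof.
move=> uL; elim: s => [|x s IHs] sL /=; first by rewrite big1.
rewrite big_split /= -IHs; last by move=> y ys; apply: sL; rewrite inE ys orbT.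
congr (_ + _)%N; have fxL : f x \in L by apply: sL; rewrite mem_head.
rewrite big_mkcond (bigD1_seq (f x)) //= eqxx big1 ?addn0; first by case: (R _).
by move=> v; rewrite eq_sym => /negPf ->; case: ifP.
Qed.

Lemma count_rem_mem (T : eqType) (a : pred T) (x : T) s : x \in s ->
  count a s = (a x + count a (rem x s))%N.
Proof. by move/perm_to_rem/permP => ->. Qed.

(** * Walks, flows and Menger's theorem *)

Section Walks.
Variable G : digraph.
Implicit Types (u v : vertex G) (e : edge G) (es p q : seq (edge G)).

Definition walk_end u es := last u (map ter es).

Lemma chain_cat u p q :
  chain u (p ++ q) <-> chain u p /\ chain (walk_end u p) q.
Proof.
elim: p u => [|e p IHp] u /=; first by split=> // -[].
by rewrite IHp; split=> [[? []]|[[]]].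
Qed.

(** If the shortened tail revisits [u], everything before that visit is dropped. *)
Lemma chain_shorten u es : chain u es ->
  exists es', [/\ chain u es', uniq (u :: map ter es'),
    walk_end u es' = walk_end u es & {subset es' <= es}].
Proof.
elim: es u => [|e es IHes] u /=; first by exists [::]; split.
move=> [eu /IHes[p [chp up endp sub]]].
have [uin|unin] := boolP (u \in ter e :: map ter p); last first.
  exists (e :: p); split => //=; first by rewrite unin.
  by move=> x; rewrite !inE => /orP[->//|/sub ->]; rewrite orbT.
suff [q1 [q [pE endq1]]] : exists q1 q, p = q1 ++ q /\ walk_end (ter e) q1 = u.
  exists q; move: chp; rewrite pE => /chain_cat[_]; rewrite endq1 => chq.
  split=> //.
  - by move: up; rewrite pE map_cat -cat_cons lastI -/(walk_end _ _) endq1 cat_rcons cat_uniq => /and3P[].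
  - by rewrite -[RHS]endp pE /walk_end map_cat last_cat -/(walk_end (ter e) q1) endq1.
  - by move=> x xq; rewrite inE sub ?orbT // pE mem_cat xq orbT.
move: uin {up chp endp sub}; move: (ter e) => w.
elim: p w => [|f p IHp] w /=.
  by rewrite inE => /eqP ->; exists [::], [::].
rewrite inE => /orP[/eqP ->|/IHp[q1 [q [-> endq]]]]; first by exists [::], (f :: p).
by exists (f :: q1), q.
Qed.

(** A flow emitting one unit per entry of [S]; vertices outside [Y] are unconstrained and serve as
    sinks. *)
Definition conserves (Y : pred (vertex G)) (F : seq (edge G)) (S : seq (vertex G)) :=
  forall v, Y v ->
    count (fun e => init e == v) F = (count (fun e => ter e == v) F + count_mem v S)%N.

(** Token [t] sits at [h t]. Outside [Y] it stops; inside [Y], conservation provides an outgoing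
    edge, which it takes and which is deleted from [F]. Either move lowers the measure bounded by
    [n]. *)
Lemma flow_decomposition (T : eqType) (Y : pred (vertex G)) n F (ts : seq T)
    (h : T -> vertex G) :
  (size F + size ts <= n)%N -> uniq F -> uniq ts -> conserves Y F (map h ts) ->
  exists P : T -> seq (edge G),
    (forall t, t \in ts ->
      [/\ chain (h t) (P t), ~~ Y (walk_end (h t) (P t)) & {subset P t <= F}]) /\
    {in ts &, forall t t', t != t' -> forall e, e \in P t -> e \notin P t'}.
Proof.
elim: n F ts h => [|n IHn] F [|t0 ts] h.
- by move=> *; exists (fun=> [::]).
- by rewrite /= addnS.
- by move=> *; exists (fun=> [::]).
rewrite /= addnS ltnS => szn uF /andP[t0ts uts] consF.
have [Yt0|nYt0] := boolP (Y (h t0)); last first.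
  have [|P [Pwalk Pdisj]] := IHn F ts h szn uF uts.
    move=> v Yv; rewrite consF //=; case: eqP => // hv.
    by rewrite hv Yv in nYt0.
  have ne t : t \in ts -> (t == t0) = false.
    by move=> tts; apply/negbTE; apply: contraNneq t0ts => <-.
  exists (fun t => if t == t0 then [::] else P t); split.
    move=> t; rewrite inE; case: eqP => [-> _|_ /=]; first by split.
    exact: Pwalk.
  move=> t t'; rewrite !inE; case: eqP => //= _ tts; case: eqP => //= _ t'ts.
  exact: Pdisj.
have /hasP[e eF /eqP ie] : has (fun e => init e == h t0) F.
  by rewrite has_count consF //= eqxx addnCA.
pose h' t := if t == t0 then ter e else h t.
have h'ts : map h' ts = map h ts.
  apply/eq_in_map => t tts; rewrite /h'; case: eqP => // tt0.
  by rewrite -tt0 tts in t0ts.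
have [||||P [Pwalk Pdisj]] := IHn (rem e F) (t0 :: ts) h'.
- have : (0 < size F)%N by case: (F) eF.
  by rewrite size_rem //=; lia.
- exact: rem_uniq.
- by rewrite /= t0ts.
- move=> v Yv; have := consF v Yv; rewrite /= h'ts {1}/h' eqxx.
  rewrite (count_rem_mem _ eF) [in RHS](count_rem_mem _ eF) ie.
  move: (count _ _) (count _ _) (count _ _) (nat_of_bool _) (nat_of_bool _).
  by move=> *; lia.
exists (fun t => if t == t0 then e :: P t else P t).
have eP t : t \in t0 :: ts -> e \notin P t.
  by move=> /Pwalk[_ _ sub]; apply/negP => /sub; rewrite mem_rem_uniq // !inE eqxx.
split=> [t tts|t t' tts t'ts tt' f].
  have [chP YP sub] := Pwalk t tts.
  have sub' : {subset P t <= F} by move=> x /sub /mem_rem.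
  move: chP YP; rewrite /h' /walk_end; case: eqP => [tt0|_] chP YP; last by split.
  rewrite -tt0 in ie.
  by split; rewrite /= ?ie //= => x; rewrite inE => /orP[/eqP -> //|/sub'].
have := Pdisj t t' tts t'ts tt' f.
have [tt0|ne] := eqVneq t t0; have [t't0|ne'] := eqVneq t' t0.
- by rewrite tt0 t't0 eqxx in tt'.
- rewrite inE => H /orP[/eqP ->|/H //]; exact: eP.
- move=> H fP; rewrite inE negb_or H // andbT; apply: contraTneq fP => ->.
  exact: eP.
- by [].
Qed.

Section Augmentation.
Variables (Y : pred (vertex G)) (A : pred (edge G)) (F0 : seq (edge G)) (s : vertex G).
Hypothesis AY : forall e, A e -> Y (init e).

(* [residual F x]: pushing one unit from [s] to [x] along residual arcs turns
   the flow [F0] into [F]. *)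
Inductive residual : seq (edge G) -> vertex G -> Prop :=
| residual_start : residual F0 s
| residual_forward F x e : residual F x -> Y x -> A e -> init e = x ->
    e \notin F -> residual (e :: F) (ter e)
| residual_backward F x e : residual F x -> Y x -> e \in F -> ter e = x ->
    residual (rem e F) (init e).

Variable S : seq (vertex G).
Hypotheses (uF0 : uniq F0) (AF0 : all A F0) (consF0 : conserves Y F0 S).

(** The extra unit is parked at [x]; once [x] is outside [Y], this is conservation for [s :: S]. *)
Lemma residual_flow F x : residual F x ->
  [/\ uniq F, all A F & forall v, Y v ->
    (count (fun e => init e == v) F + (x == v) =
     count (fun e => ter e == v) F + count_mem v S + (s == v))%N].
Proof.
elim=> {F x} [|F x e _ [uF AF cF] Yx Ae ex eF|F x e _ [uF AF cF] Yx eF ex].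
- by split=> // v Yv; rewrite consF0.
- split=> /= [|| v Yv]; [by rewrite eF|by rewrite Ae|].
  have := cF v Yv; rewrite /= ex; move: (count _ _) (count _ _) (count _ _).
  by move: (nat_of_bool _) (nat_of_bool _) (nat_of_bool _) => *; lia.
- split=> [|| v Yv]; first exact: rem_uniq.
    by apply/allP => f /mem_rem /(allP AF).
  have := cF v Yv; rewrite (count_rem_mem _ eF) [in RHS](count_rem_mem _ eF).
  rewrite ex; move: (count _ _) (count _ _) (count _ _).
  by move: (nat_of_bool _) (nat_of_bool _) (nat_of_bool _) => *; lia.
Qed.

(** If no residual walk leaves [Y], let [R] be the set of reachable vertices. Every [A]-edge leaving
    [R] is in [F0], and no edge of [F0] enters [R]. Conservation over [R] then yields exactly
    [count R S] leaving edges, one too few for [s :: S]. *)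
Lemma augment :
  (forall (R : pred (vertex G)) (L : seq (edge G)), {subset R <= Y} ->
    (forall e, A e -> R (init e) -> ~~ R (ter e) -> e \in L) ->
    (count R (s :: S) <= size L)%N) ->
  exists F, [/\ uniq F, all A F & conserves Y F (s :: S)].
Proof.
move=> hall; apply: contrapT => noF.
have resY F x : residual F x -> Y x.
  move=> res; apply: contrapT => /negP nYx; apply: noF; exists F.
  have [uF AF cF] := residual_flow res; split=> // v Yv.
  have := cF v Yv; case: eqP => [xv|_ /=]; last by lia.
  by rewrite xv Yv in nYx.
pose R v := `[< exists F, residual F v >].
have RY : {subset R <= Y} by move=> v /asboolP[F] /resY.
(* Only edges with both ends reachable are ever added or removed. *)
have unchanged F x : residual F x -> forall e, ~~ (R (init e) && R (ter e)) ->
    (e \in F) = (e \in F0).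
  elim=> {F x} [//|F x e res IH Yx Ae ex eF|F x e res IH Yx eF ex] f Rf.
    have [fe|nfe] := eqVneq f e; last by rewrite inE (negPf nfe) IH.
    case/negP: Rf; rewrite fe; apply/andP; split; apply/asboolP.
      by exists F; rewrite ex.
    by exists (e :: F); apply: residual_forward Ae ex eF.
  have [fe|nfe] := eqVneq f e; last first.
    by have [uF _ _] := residual_flow res; rewrite mem_rem_uniq // !inE nfe IH.
  case/negP: Rf; rewrite fe; apply/andP; split; apply/asboolP.
    by exists (rem e F); apply: residual_backward eF ex.
  by exists F; rewrite ex.
have out e : A e -> R (init e) -> ~~ R (ter e) -> e \in F0.
  move=> Ae Ri Rt; have /asboolP[F res] := Ri.
  rewrite -(unchanged _ _ res); last by rewrite negb_and Rt orbT.
  apply: contraNT Rt => eF; apply/asboolP; exists (e :: F).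
  by apply: (residual_forward res (AY Ae) Ae _ eF).
have inn e : e \in F0 -> R (ter e) -> R (init e).
  move=> eF0 Rt; apply: contrapT => /negP Ri; have /asboolP[F res] := Rt.
  move: eF0; rewrite -(unchanged _ _ res); last by rewrite negb_and Ri.
  move=> eF; case/negP: Ri; apply/asboolP; exists (rem e F).
  by apply: residual_backward res _ eF _ => //; exact: RY.
have Rs : R s by apply/asboolP; exists F0; exact: residual_start.
pose L := [seq e <- F0 | R (init e) && ~~ R (ter e)].
have : (count R (s :: S) <= size L)%N.
  by apply: hall => // e Ae Ri Rt; rewrite mem_filter Ri Rt out.
rewrite /= Rs size_filter => hS.
have cnt : count (fun e => R (init e)) F0 =
    (count (fun e => R (ter e)) F0 + count R S)%N.
  pose W := undup (map init F0 ++ map ter F0 ++ S).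
  have uW : uniq W by exact: undup_uniq.
  rewrite (count_fibers (f := init) R uW) => [|e eF]; last first.
    by rewrite mem_undup mem_cat map_f.
  rewrite (count_fibers (f := ter) R uW) => [|e eF]; last first.
    by rewrite mem_undup !mem_cat map_f ?orbT.
  rewrite (count_fibers (f := id) R uW) => [|v vS]; last first.
    by rewrite mem_undup !mem_cat vS !orbT.
  by rewrite -big_split; apply: eq_bigr => v /RY Yv /=; rewrite consF0.
have := count_predC (fun e => R (ter e)) [seq e <- F0 | R (init e)].
rewrite size_filter !count_filter cnt.
rewrite (@eq_in_count _ _ (fun e => R (ter e)) F0); last first.
  by move=> e eF /=; case Rt: (R _) => //=; rewrite inn.
rewrite (@eq_count _ (predI (predC _) _) (fun e => R (init e) && ~~ R (ter e))); last first.
  by move=> e /=; rewrite andbC.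
by move/addnI => outE; rewrite outE ltnn in hS.
Qed.

End Augmentation.

Lemma menger_flow (Y : pred (vertex G)) (A : pred (edge G)) (S : seq (vertex G)) :
  (forall e, A e -> Y (init e)) ->
  (forall (R : pred (vertex G)) (L : seq (edge G)), {subset R <= Y} ->
    (forall e, A e -> R (init e) -> ~~ R (ter e) -> e \in L) ->
    (count R S <= size L)%N) ->
  exists F, [/\ uniq F, all A F & conserves Y F S].
Proof.
move=> AY; elim: S => [|s S IHS] hall; first by exists [::].
have [|F [uF AF cF]] := IHS.
  by move=> R L RY RL; apply: leq_trans (hall R L RY RL); rewrite leq_addl.
exact: (augment AY uF AF cF).
Qed.

(* [L] stands for a finite edge cut: an infinite one imposes no condition. *)
Lemma menger (T : eqType) (Y : pred (vertex G)) (A : pred (edge G)) (ts : seq T)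
    (h : T -> vertex G) :
  (forall e, A e -> Y (init e)) -> uniq ts ->
  (forall (R : pred (vertex G)) (L : seq (edge G)), {subset R <= Y} ->
    (forall e, A e -> R (init e) -> ~~ R (ter e) -> e \in L) ->
    (count (fun t => R (h t)) ts <= size L)%N) ->
  exists P : T -> seq (edge G),
    (forall t, t \in ts ->
      [/\ chain (h t) (P t), uniq (h t :: map ter (P t)),
          ~~ Y (walk_end (h t) (P t)) & {in P t, forall e, A e}]) /\
    {in ts &, forall t t', t != t' -> forall e, e \in P t -> e \notin P t'}.
Proof.
move=> AY uts hall.
have [|F [uF AF cF]] := @menger_flow Y A (map h ts) AY.
  by move=> R L RY RL; rewrite count_map; exact: hall.
have [P [Pwalk Pdisj]] := flow_decomposition (leqnn _) uF uts cF.
have /choice[Q PQ] t : exists q, t \in ts -> [/\ chain (h t) q,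
    uniq (h t :: map ter q), walk_end (h t) q = walk_end (h t) (P t) &
    {subset q <= P t}].
  have [tts|//] := boolP (t \in ts); last by exists [::].
  by have [/chain_shorten[q ?] _ _] := Pwalk t tts; exists q.
exists Q; split=> [t tts|t t' tts t'ts tt' e].
  have [? ? -> QP] := PQ t tts; have [_ ? PF] := Pwalk t tts.
  by split=> // e /QP/PF/(allP AF).
have [_ _ _ QP] := PQ t tts; have [_ _ _ QP'] := PQ t' t'ts.
by move=> /QP eP; apply: contra (Pdisj t t' tts t'ts tt' e eP) => /QP'.
Qed.

End Walks.

(** * Cardinalities of finite sets *)

HB.instance Definition _ (G : digraph) := gen_eqMixin (dipath G).
HB.instance Definition _ (G : digraph) := gen_choiceMixin (dipath G).

(* The junk value for an infinite set is [0]. *)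
Definition ncard (T : choiceType) (A : set T) : nat := #|` fset_set A|%fset.

Section Ncard.
Variable T : choiceType.
Implicit Types (A B : set T) (s : seq T).

Lemma sub_ncard A B : finite_set B -> A `<=` B -> (ncard A <= ncard B)%N.
Proof.
move=> fB AB; have fA := sub_finite_set AB fB.
by apply: fsubset_leq_card; rewrite -fset_set_sub.
Qed.

Lemma ncardU A B : finite_set A -> finite_set B -> (forall x, A x -> ~ B x) ->
  ncard (A `|` B) = (ncard A + ncard B)%N.
Proof.
move=> fA fB AB; rewrite /ncard fset_setU // -cardfsUI -fset_setI //.
suff -> : A `&` B = set0 by rewrite fset_set0 cardfs0 addn0.
by apply/seteqP; split=> x // -[/AB].
Qed.

Lemma ncard_uniq A s : uniq s -> (forall x, x \in s <-> A x) -> ncard A = size s.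
Proof.
move=> us sA; have AE : A = [set` s] by apply/seteqP; split=> x /sA.
apply/perm_size/uniq_perm => // x.
by rewrite AE in_fset_set //; apply/idP/idP; rewrite inE.
Qed.

Lemma ncard_le_size A s : A `<=` [set` s] -> (ncard A <= size s)%N.
Proof.
move=> As; apply: leq_trans (size_undup s).
rewrite -(@ncard_uniq [set` s] (undup s)) ?undup_uniq //; first exact: sub_ncard.
by move=> x; rewrite mem_undup.
Qed.

(** Finiteness must come with the bound, which alone is vacuous for an infinite set. *)
Lemma ncard_bounded A n :
  (forall B, finite_set B -> B `<=` A -> (ncard B <= n)%N) ->
  finite_set A /\ (ncard A <= n)%N.
Proof.
move=> bnd; have fA : finite_set A; last by split=> //; exact: bnd.
apply: contrapT => /(@infinite_set_fset _ _ n.+1)[B BA].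
by rewrite leqNgt ltnS -{1}[B]set_fsetK [X in ~~ X]bnd.
Qed.

End Ncard.

Lemma ncard_image (T U : choiceType) (f : T -> U) (A : set T) : finite_set A ->
  (forall x y, A x -> A y -> f x = f y -> x = y) -> ncard (f @` A) = ncard A.
Proof.
move=> fA inj; rewrite /ncard fset_set_image // card_in_imfset //= => x y.
by rewrite !in_fset_set // !inE; exact: inj.
Qed.

Lemma ncard_transversal (J T : choiceType) (A : set J) (F : J -> set T) (C : set T) :
  finite_set C -> trivIset A F -> (forall j, A j -> exists e, F j e /\ C e) ->
  finite_set A /\ (ncard A <= ncard C)%N.
Proof.
move=> fC tF AC; apply: ncard_bounded => B fB BA.
(* The unit summand is a default value outside [A], since [T] may be empty. *)
have /choice[f fP] j : exists e : T + unit, A j -> exists e0, e = inl e0 /\ F j e0 /\ C e0.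
  have [/AC[e [Fe Ce]]|nA] := pselect (A j); first by exists (inl e) => _; exists e.
  by exists (inr tt).
have sub : f @` B `<=` inl @` C.
  by move=> _ [j /BA/fP[e [-> [_ Ce]]] <-]; exists e.
rewrite -(@ncard_image _ _ f) //.
  apply: leq_trans (sub_ncard _ sub) _; first exact: finite_image.
  by rewrite ncard_image // => x y _ _ [].
move=> x y /BA Ax /BA Ay; have [e [-> [Fe _]]] := fP x Ax.
have [e' [-> [Fe' _]]] := fP y Ay => -[ee']; apply: tF => //.
by exists e; split=> //; rewrite ee'.
Qed.

(** * Cuts, good sets and the links inside one layer *)

Section Cuts.
Variables (G : digraph) (b : vertex G) (I : set (vertex G)).
Local Notation V := (vertex G).
Local Notation E := (edge G).
Implicit Types (X Y U : set V) (u v : V) (e : E).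

Definition boundary X : set E := [set e | X (init e) /\ ~ X (ter e)].

Definition cut X := ~ X b /\ finite_set (boundary X).

Lemma cut0 : cut set0.
Proof.
split=> //; rewrite (_ : boundary set0 = set0); first exact: finite_set0.
by apply/seteqP; split=> e // -[].
Qed.

Lemma cutU X Y : cut X -> cut Y -> cut (X `|` Y).
Proof.
move=> [Xb fX] [Yb fY]; split=> [[]//|].
apply: (@sub_finite_set _ _ (boundary X `|` boundary Y)); last by rewrite finite_setU.
by move=> e [[Xe|Ye] /not_orP[? ?]]; [left|right].
Qed.

Lemma chain_crosses X u es : chain u es -> X u -> ~ X (walk_end u es) ->
  exists2 e, e \in es & boundary X e.
Proof.
elim: es u => [|e es IHes] u /=; first by move=> _ Xu.
move=> [<- ch] Xe end_es; have [Xt|nXt] := pselect (X (ter e)).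
  by have [f fes Bf] := IHes _ ch Xt end_es; exists f; rewrite // inE fes orbT.
by exists e; rewrite ?mem_head.
Qed.

Lemma dipath_crosses X (p : dipath G) : X (path_start p) -> ~ X (path_end p) ->
  exists e, path_edges p e /\ boundary X e.
Proof.
move=> Xs Xe; have [e /InP ein Be] := chain_crosses (@path_chain _ p) Xs Xe.
by exists e.
Qed.

Lemma cut_no_disjoint_paths X (A : set V) : cut X -> A `<=` X ->
  ~ inf_disjoint_paths A b.
Proof.
move=> [Xb fX] AX [P [infP tP Pb]]; apply: infP.
have [] // := ncard_transversal fX tP.
by move=> p /Pb[/AX Xs pe]; apply: dipath_crosses => //; rewrite pe.
Qed.

Definition walk_dipath u es (ch : chain u es) (un : uniq (u :: map ter es)) : dipath G :=
  DiPath ch (elimT (NoDupP _) un).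

(** Take a maximal edge-disjoint family [P] of paths from [A] to [b]. If it is finite, the vertices
    reachable from [A] without its edges form a cut: only edges of [P] leave this set, and reaching
    [b] would give one more path. *)
Lemma cut_or_disjoint_paths (A : set V) : ~ A b ->
  (exists X, cut X /\ A `<=` X) \/ inf_disjoint_paths A b.
Proof.
move=> nAb.
pose D := [set p : dipath G | A (path_start p) /\ path_end p = b].
have [P [PD tP maxP]] := ex_maximal_disjoint_subcollection (@path_edges G) D.
have [fP|infP] := pselect (finite_set P); last by right; exists P.
left; pose F := \bigcup_(p in P) path_edges p.
have fF : finite_set F.
  apply: bigcup_finite => // p _; apply/finite_seqP; exists (path_seq p).
  by apply/seteqP; split=> e /InP.
pose X := [set v | exists a es, [/\ A a, chain a es, walk_end a es = v &
  forall e, e \in es -> ~ F e]].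
exists X; split; last by move=> a Aa; exists a, [::].
split; last first.
  apply: (sub_finite_set _ fF) => e [[a [es [Aa ch endes esF]]] nX].
  apply: contrapT => nFe; apply: nX; exists a, (rcons es e); split=> //.
  - by rewrite -cats1; apply/chain_cat; rewrite endes.
  - by rewrite /walk_end map_rcons last_rcons.
  - by move=> f; rewrite mem_rcons inE => /orP[/eqP ->//|/esF].
move=> [a [es [Aa ch endes esF]]].
have [es' [ch' un' end' sub]] := chain_shorten ch.
pose p := walk_dipath ch' un'.
have pF e : path_edges p e -> ~ F e by move=> /InP/= /sub/esF.
have Dp : D p by split=> //=; rewrite -endes -end'.
(* As [b] is not in [A], the path [p] has an edge, which would lie in [F] if [p] were in [P]. *)
have nPp : ~ P p.
  move=> Pp; have [||e [pe _]] := @dipath_crosses [set~ b] p.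
  - by move=> /= ab; rewrite -ab in nAb.
  - by move=> /=; apply; case: Dp.
  - by apply: (pF _ pe); exists p.
apply: (maxP (P `|` [set p])).
- by split=> [x|sub']; [left|apply: nPp; apply: sub'; right].
- by move=> x [/PD//|->].
- move=> x y [Px|->] [Py|->] // [e [xe ye]].
  + by apply: tP => //; exists e.
  + by case: (pF e) => //; exists x.
  + by case: (pF e) => //; exists y.
Qed.

Definition target (t : V + E) : V := match t with inl a => a | inr e => ter e end.

Definition incoming U Y : set (V + E) :=
  [set t | Y (target t) /\ match t with inl a => I a | inr e => U (init e) end].

Definition outgoing U Y : set E :=
  [set e | Y (init e) /\ ~ U (ter e) /\ ~ Y (ter e)].

(* The cut condition for linking [I] outside [U] and all edges leaving [U]
   to [b], restricted to the traces of the cuts of the whole digraph. *)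
Definition good U := forall X, cut X ->
  finite_set (incoming U (X `\` U)) /\
  (ncard (incoming U (X `\` U)) <= ncard (outgoing U (X `\` U)))%N.

Lemma outgoing_boundary U X : outgoing U (X `\` U) `<=` boundary X.
Proof. by move=> e [[Xi Ui] [Ut /not_andP[//|nn]]]; case: nn. Qed.

Lemma finite_outgoing U X : cut X -> finite_set (outgoing U (X `\` U)).
Proof. by move=> [_]; apply: sub_finite_set; exact: outgoing_boundary. Qed.

(** For finitely many sources in [X], the paths of a linkage leave [X] through distinct edges. *)
Lemma good0 :
  (forall S : set V, S `<=` I -> finite_set S -> has_linkage S b) -> good set0.
Proof.
move=> link X [Xb fX]; apply: ncard_bounded => T fT TX.
have TE : T = inl @` (inl @^-1` T).
  apply/seteqP; split=> t; last by move=> [a ? <-].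
  by case: t => [a Ta|e /TX[_ []]]; exists a.
have fS : finite_set (inl @^-1` T : set V).
  by apply: finite_preimage => // x y _ _ [].
have [|P [tP Pb]] := link (inl @^-1` T) _ fS; first by move=> a /TX[].
rewrite TE ncard_image // => [|x y _ _ []] //.
have fO : finite_set (outgoing set0 (X `\` set0)) by exact: finite_outgoing.
have [] // := ncard_transversal fO tP.
move=> a Ta; have [ps pe] := Pb a Ta; have [[Xa _] _] := TX _ Ta.
have [||e [ep [Xi Xt]]] := @dipath_crosses X (P a); rewrite ?ps ?pe //.
by exists e; do !split=> //; case.
Qed.

(** An edge leaving the intersection leaves [X] or is one of the finitely many edges entering the
    rest of [X] from [U]. *)
Lemma good_cutI U X : good U -> cut X -> cut (X `&` U).
Proof.
move=> gU cX; have [fin _] := gU X cX; have [Xb fX] := cX.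
split=> [[]//|].
have fI : finite_set (inr @^-1` incoming U (X `\` U) : set E).
  by apply: finite_preimage => // x y _ _ [].
apply: (@sub_finite_set _ _ (boundary X `|` inr @^-1` incoming U (X `\` U))).
  by move=> e [[Xi Ui] /not_andP[Xt|Ut]]; have [Xt'|nXt] := pselect (X (ter e));
    [|left| right|left].
by rewrite finite_setU.
Qed.

Lemma finite_sub_bigcup_chain (J : Type) (T : eqType) (D : set J) (C : J -> set T)
    (W : set T) :
  finite_set W -> D !=set0 ->
  (forall i j, D i -> D j -> C i `<=` C j \/ C j `<=` C i) ->
  W `<=` \bigcup_(j in D) C j -> exists2 j, D j & W `<=` C j.
Proof.
move=> + [j0 Dj0] tot.
move=> /finite_seqP[s ->]; elim: s => [|x s IHs] WC; first by exists j0.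
have [|j Dj sj] := IHs; first by move=> y ys; apply: WC; rewrite /= inE [y \in s]ys orbT.
have [|i Di ix] := WC x; first by rewrite /= mem_head.
have [ij|ji] := tot i j Di Dj.
  by exists j => // y /=; rewrite inE => /orP[/eqP ->|/sj//]; exact: ij.
by exists i => // y /=; rewrite inE => /orP[/eqP ->//|/sj]; exact: ji.
Qed.

(* For a member [C j] of the chain containing all endpoints of [boundary X] that
   lie in the union, no edge leaving [X `\` C j] outside [C j] meets the union. *)
Lemma good_bigcup (J : Type) (D : set J) (C : J -> set V) : D !=set0 ->
  (forall i j, D i -> D j -> C i `<=` C j \/ C j `<=` C i) ->
  (forall j, D j -> good (C j)) -> good (\bigcup_(j in D) C j).
Proof.
move=> D0 tot gC X cX; set U := \bigcup_(j in D) C j.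
have [_ fX] := cX; apply: ncard_bounded => T fT TX.
(* The tails of edges in [T] are included so that these edges already start in the chosen [C j]. *)
pose ends := init @` boundary X `|` ter @` boundary X `|`
  (fun t : V + E => match t with inl a => a | inr e => init e end) @` T.
have fends : finite_set (ends `&` U).
  apply: (@sub_finite_set _ _ ends); first by move=> x [].
  by rewrite !finite_setU; do !split; exact: finite_image.
have [//|j Dj jends] := finite_sub_bigcup_chain fends D0 tot.
have CU : C j `<=` U by move=> x; exists j.
have [fin le] := gC j Dj X cX.
have TC : T `<=` incoming (C j) (X `\` C j).
  move=> t Tt; have [[Xh Uh] tI] := TX t Tt; split; first by split=> // /CU.
  case: t Tt Xh Uh tI => // e Te _ _ Ue.
  by apply: jends; split=> //; right; exists (inr e).
have OU : outgoing (C j) (X `\` C j) `<=` outgoing U (X `\` U).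
  move=> e Oe; have [Xi nXt] := outgoing_boundary Oe; have [[_ Ci] [Ct _]] := Oe.
  have inU x : ends x -> ~ C j x -> ~ U x by move=> ? Cx Ux; apply: Cx; exact: jends.
  have nUi : ~ U (init e) by apply: inU => //; left; left; exists e.
  have nUt : ~ U (ter e) by apply: inU => //; left; right; exists e.
  by split; [split|split=> // -[]].
apply: leq_trans (sub_ncard fin TC) _; apply: leq_trans le _.
by apply: sub_ncard OU; exact: finite_outgoing.
Qed.

(* No truncation occurs when [U] is good and [X] is a cut. *)
Definition slack U X : nat :=
  (ncard (outgoing U (X `\` U)) - ncard (incoming U (X `\` U)))%N.

(* [tauto] is intuitionistic: give it excluded middle for every membership. *)
Local Ltac membership :=
  rewrite /setU /setI /setD /setC /mkset /=;
  repeat match goal with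
  | |- context [?X (@init ?G ?e)] => is_var X; move: (EM (X (@init G e)))
     ; move: (X (@init G e)) => ?
  | |- context [?X (@ter ?G ?e)] => is_var X; move: (EM (X (@ter G e)))
     ; move: (X (@ter G e)) => ?
  | |- context [?X (target ?e)] => is_var X; move: (EM (X (target e)))
     ; move: (X (target e)) => ?
  end; tauto.

(** [X1] minimises the slack among cuts containing [X0], so adding [X] does not lower it. Cancelling
    common terms leaves the inequality required of the enlarged good set. *)
Lemma good_step U X0 : good U -> cut X0 ->
  exists X1, [/\ cut X1, X0 `<=` X1 & good (U `|` X1)].
Proof.
move=> gU cX0.
pose slacks n := `[< exists X, [/\ cut X, X0 `<=` X & slack U X = n] >].
have exn : exists n, slacks n.
  by exists (slack U X0); apply/asboolP; exists X0; split.
case: (ex_minnP exn) => _ /asboolP[X1 [cX1 X01 <-]] minX1.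
exists X1; split=> // X cX; have cX2 := cutU cX1 cX.
have {minX1} : (slack U X1 <= slack U (X1 `|` X))%N.
  apply: minX1; apply/asboolP; exists (X1 `|` X); split=> //.
  by move=> x /X01; left.
have [fin1 le1] := gU X1 cX1; have [fin2 le2] := gU _ cX2.
have fout1 := finite_outgoing U cX1.
have fout2 := finite_outgoing U cX2.
set Y := X `\` (U `|` X1); rewrite /slack.
(* Edges in [A] leave both [X1] and its enlargement by [X]. Edges in [B] leave [X1] but enter [Y],
   so they become incoming once [X1] is absorbed. *)
pose A := [set e |
  (X1 (init e) /\ ~ U (init e)) /\ ~ U (ter e) /\ ~ (X1 `|` X) (ter e)].
pose B := [set e | (X1 (init e) /\ ~ U (init e)) /\ Y (ter e)].
have out2E : outgoing U ((X1 `|` X) `\` U) = A `|` outgoing (U `|` X1) Y.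
  apply/seteqP; split=> e; rewrite /outgoing /A /Y /=; membership.
have out1E : outgoing U (X1 `\` U) = A `|` B.
  apply/seteqP; split=> e; rewrite /outgoing /A /B /Y /=; membership.
have in2E : incoming U ((X1 `|` X) `\` U) =
    incoming U (X1 `\` U) `|` incoming U Y.
  apply/seteqP; split=> e; rewrite /incoming /Y /=; membership.
have inE : incoming (U `|` X1) Y = incoming U Y `|` inr @` B.
  apply/seteqP; split=> -[a|e]; rewrite /incoming /B /Y /=.
  - by tauto.
  - have [Ui|nUi] := pselect (U (init e)); first by tauto.
    by move=> ?; right; exists e => //; tauto.
  - by case=> [|[? _ []]].
  - by case=> [|[f + [<-]]]; tauto.
rewrite out2E in fout2 le2 *; rewrite out1E in fout1 le1 *.
rewrite in2E in fin2 le2 *; rewrite inE => le12.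
move: fout1 fout2 fin2; rewrite !finite_setU => -[fA fB] [_ fO] [_ fI].
have fB' : finite_set (inr @` B : set (V + E)) by exact: finite_image.
split=> //.
move: le1 le2 le12; rewrite !ncardU //.
- rewrite (@ncard_image _ _ inr) // => [|x y _ _ [] //].
  by move: (ncard _) (ncard _) (ncard _) (ncard _) (ncard _) => *; lia.
- by move=> _ /[swap] -[f [[_ nU] _] <-] [].
- by move=> e; rewrite /outgoing /A /Y /=; tauto.
- by move=> e; rewrite /incoming /Y /=; tauto.
- by move=> e; rewrite /A /B /Y /=; tauto.
Qed.

(** Menger's theorem inside the layer, with edges back into [U] forbidden so that every link exits
    upwards. *)
Lemma layer_linkage U X1 : good U -> cut X1 ->
  exists P : V + E -> seq E,
    (forall t, incoming U (X1 `\` U) t ->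
      [/\ chain (target t) (P t), uniq (target t :: map ter (P t)),
          ~ (X1 `\` U) (walk_end (target t) (P t)) &
          forall e, e \in P t -> (X1 `\` U) (init e) /\ ~ U (ter e)]) /\
    trivIset (incoming U (X1 `\` U)) (fun t => [set` P t]).
Proof.
move=> gU cX1; set Y := X1 `\` U.
have [finY _] := gU X1 cX1.
have /finite_seqP[ts0 inY] := finY; pose ts := undup ts0.
have tsP t : t \in ts <-> incoming U Y t by rewrite mem_undup inY.
pose A e := (init e \in Y) && (ter e \notin U).
have [|||P [Pw Pd]] := @menger G _ (fun v => v \in Y) A ts target.
- by move=> e /andP[].
- exact: undup_uniq.
- move=> R L RY RL.
  have RY' v : R v -> Y v by move=> /RY; rewrite /in_mem /= => /set_mem.
  (* Adding the part of [X1] in [U] gives a cut with trace [R]: an edge from [R] into [U] stays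
     inside [X'] or leaves [X1]. *)
  pose X' := [set` R] `|` (X1 `&` U).
  have X'U : X' `\` U = [set` R].
    apply/seteqP; split=> v; first by move=> [[//|[]]].
    by move=> Rv; have [_ nU] := RY' v Rv; split=> //; left.
  have RLb e : R (init e) -> ~ R (ter e) -> ~ U (ter e) -> e \in L.
    move=> Ri Rt Ut; apply: RL => //; last exact/negP.
    by apply/andP; split; [exact/mem_set/RY'|apply/negP => /set_mem].
  have [nX1b fX1] := cX1.
  have cX' : cut X'.
    split; first by move=> [/RY'[]//|[]//].
    apply: (@sub_finite_set _ _ ([set` L] `|` boundary X1 `|` boundary (X1 `&` U))).
      move=> e [Xi /not_orP[Rt XUt]].
      have [XUi|nXUi] := pselect ((X1 `&` U) (init e)); first by right; split.
      case: Xi => // Ri; left; have [Ut|nUt] := pselect (U (ter e)).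
        by right; split; [have [] := RY' _ Ri|move=> Xt; apply: XUt].
      by left; apply: RLb.
    by rewrite !finite_setU; do !split => //; have [] := good_cutI gU cX1.
  have [fin' le'] := gU X' cX'; move: le' fin'; rewrite X'U => le' fin'.
  apply: (@leq_trans (ncard (incoming U [set` R]))).
    rewrite -size_filter -(@ncard_uniq _ (incoming U [set` R]) _) //.
    + by rewrite filter_uniq // undup_uniq.
    + move=> t; rewrite mem_filter; split.
        by move=> /andP[Rt /tsP[_ ?]]; split.
      by move=> [Rt ?]; apply/andP; split; [exact: Rt|]; apply/tsP; split=> //; exact: RY'.
  apply: leq_trans le' (ncard_le_size _).
  by move=> e [Ri [Ut Rt]]; exact: RLb.
exists P; split=> [t /tsP tts|t t' /tsP tts /tsP t'ts [e [eP eP']]].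
  have [? ? YP AP] := Pw t tts; split=> // [Ye|e /AP/andP[Yi Ut]].
    by move/negP: YP; apply; exact/mem_set.
  by split; [exact/set_mem|move=> Ute; move/negP: Ut; apply; exact/mem_set].
apply: contrapT => /eqP tt'; have := Pd t t' tts t'ts tt' e eP.
by rewrite [e \in _]eP'.
Qed.

End Cuts.

(** * Well-ordering and the transfinite construction of layers *)

Lemma exists_well_order (T : eqType) : exists lt : T -> T -> Prop,
  [/\ well_founded lt, forall x y z, lt x y -> lt y z -> lt x z & forall x y, [\/ lt x y, x = y | lt y x]].
Proof.
have [R wo] := wochoice.well_ordering_principle T.
have wo' : wochoice.wo_chain R predT by move=> A _; exact: wo.
have tot : total R by move=> x y; exact: (wochoice.wo_chainW wo' isT isT).
have anti x y : R x y -> R y x -> x = y.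
  by move=> xy yx; apply: (wochoice.wo_chain_antisymmetric wo' isT isT); rewrite xy yx.
pose lt x y := is_true (~~ R y x).
have ltP x y : [\/ lt x y, x = y | lt y x].
  have [xy|nxy] := boolP (R x y); last by constructor 3.
  by have [yx|nyx] := boolP (R y x); [constructor 2; exact: anti|constructor 1].
have wf : well_founded lt.
  move=> x; apply: contrapT => nAx.
  have [|z [[zA minz] _]] := wo (fun y => `[< ~ Acc lt y >]).
    by exists x; apply/asboolP.
  move/asboolP: zA; apply; constructor=> y /negP zy; apply: contrapT => nAy.
  by apply: zy; apply: minz; apply/asboolP.
(* By trichotomy, transitivity can only fail through a cyclic triple, which well-foundedness
   excludes. *)
have no_cycle x y z : lt x y -> lt y z -> ~ lt z x.
  elim/(well_founded_ind wf): x y z => x IH y z xy yz zx.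
  exact: (IH z zx x y zx xy yz).
exists lt; split=> // x y z xy yz; have [//|xz|zx] := ltP x z.
- by have := tot x y; rewrite -xz in yz; rewrite (negPf xy) (negPf yz).
- by case: (no_cycle _ _ _ xy yz).
Qed.

Section Layering.
Variables (G : digraph) (b : vertex G) (I : set (vertex G)).
Local Notation V := (vertex G).
Local Notation good := (good b I).
Local Notation cut := (cut b).

Definition covered (x : V) := exists2 X, cut X & X x.

(** The stages are indexed by the vertices themselves: stage [v] adds a cut containing [v] when
    there is one, so a covered vertex is absorbed by its own stage at the latest. *)
Lemma layering : good set0 ->
  exists (lt : V -> V -> Prop) (Low X : V -> set V),
    [/\ well_founded lt, forall u v w, lt u v -> lt v w -> lt u w &
      forall v w, [\/ lt v w, v = w | lt w v]] /\
    [/\ forall v, good (Low v), forall v, good (Low v `|` X v),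
      forall v, cut (X v),
      forall v, Low v = \bigcup_(w in [set w | lt w v]) (Low w `|` X w) &
      forall v, covered v -> (Low v `|` X v) v].
Proof.
move=> g0; have [lt [wf tr tri]] := exists_well_order V.
(* Goodness is a premise inside the choice, so [sel] can drive the recursion before the stages are
   known to be good. *)
have /choice[sel selP] (p : set V * V) : exists X, [/\ cut X,
    good p.1 -> good (p.1 `|` X) & covered p.2 -> X p.2].
  case: p => U v /=; have [X0 [cX0 X0v]] : exists X0, cut X0 /\ (covered v -> X0 v).
    have [[X0 cX0 X0v]|nc] := pselect (covered v); first by exists X0.
    by exists set0; split=> //; exact: cut0.
  have [gU|ngU] := pselect (good U); last by exists X0; split.
  have [X1 [cX1 X01 gX1]] := good_step gU cX0.
  by exists X1; split=> // /X0v/X01.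
pose step v (rec : forall w, lt w v -> set V) : set V :=
  let L := [set x | exists w (h : lt w v), rec w h x] in L `|` sel (L, v).
pose U := Fix wf (fun=> set V) step.
pose Low v := \bigcup_(w in [set w | lt w v]) U w.
have UE v : U v = Low v `|` sel (Low v, v).
  rewrite /U Fix_eq.
    rewrite /step -/U; set L := [set x | _].
    suff -> : L = Low v by [].
    by apply/seteqP; split=> x => [[w [h Ux]]|[w h Ux]]; exists w => //; exists h.
  move=> x f g fg; congr (step x _).
  by apply/functional_extensionality_dep => y; apply/functional_extensionality_dep => h.
have Umono v w : lt v w -> U v `<=` Low w by move=> vw x Ux; exists v.
have gU v : good (Low v) /\ good (U v).
  elim/(well_founded_ind wf): v => v IH.
  suff gL : good (Low v) by split=> //; rewrite UE; have [_ + _] := selP (Low v, v); apply.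
  (* Successor and limit stages are alike: [Low v] is the union of a nonempty chain, except at the
     least [v]. *)
  have [[w wv]|ne] := pselect (exists w, lt w v).
    apply: good_bigcup => [|x y _ _|x /IH[]] //; first by exists w.
    have [xy|->|yx] := tri x y; [left|by left|right] => z.
      by rewrite (UE y) => /(Umono _ _ xy); left.
    by rewrite (UE x) => /(Umono _ _ yx); left.
  suff -> : Low v = set0 by [].
  by apply/seteqP; split=> x // [w wv]; case: ne; exists w.
exists lt, Low, (fun v => sel (Low v, v)); split=> //; split=> v.
- by have [] := gU v.
- by rewrite -UE; have [] := gU v.
- by have [] := selP (Low v, v).
- by apply: eq_bigcupr => w _; rewrite -UE.
- by move=> cv; right; have [_ _] := selP (Low v, v); apply.
Qed.

End Layering.

(** * Vertex lists of chains *)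

Section Trails.
Variable G : digraph.
Implicit Types (es : seq (edge G)) (e : edge G) (u : vertex G).

Lemma chain_nth e0 u es i : chain u es -> (i.+1 < size es)%N ->
  init (nth e0 es i.+1) = ter (nth e0 es i).
Proof.
elim: es u i => [|e es IHes] u [|i] //= [_ ch]; last exact: IHes ch.
by case: es ch {IHes} => [|f es] //= [].
Qed.

Lemma chain_map_init u es : chain u es ->
  rcons (map init es) (walk_end u es) = u :: map ter es.
Proof. by elim: es u => [|e es IHes] u //= [<- /IHes ->]. Qed.

Lemma mkseq_chain (s : nat -> edge G) n :
  (forall k, (k < n)%N -> ter (s k) = init (s k.+1)) ->
  chain (init (s 0)) (mkseq s n.+1) /\
  walk_end (init (s 0)) (mkseq s n.+1) = ter (s n).
Proof.
move=> tn; suff ch : chain (init (s 0)) (mkseq s n.+1).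
  by split=> //; rewrite mkseqS /walk_end map_rcons last_rcons.
elim: n tn => [|n IHn] tn; first by [].
rewrite mkseqS -cats1; apply/chain_cat; split.
  by apply: IHn => k kn; apply: tn; exact: ltnW.
by rewrite mkseqS /walk_end map_rcons last_rcons /= tn.
Qed.

End Trails.

(** * Concatenation of links into paths and rays *)

Section Routing.
Variables (G : digraph) (b : vertex G) (I : set (vertex G)).
Local Notation V := (vertex G).
Local Notation E := (edge G).
Local Notation good := (good b I).
Local Notation cut := (cut b).
Local Notation covered := (covered b).

(** [Low v] and [W v] are the sets built before and after stage [v]; [rank x] is the stage absorbing
    [x]. *)
Variables (lt : V -> V -> Prop) (Low W : V -> set V) (rank : V -> V).
Hypotheses (lt_irr : forall x, ~ lt x x)
  (lt_trans : forall x y z, lt x y -> lt y z -> lt x z)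
  (goodW : forall v, good (W v))
  (W_total : forall v w, W v `<=` W w \/ W w `<=` W v)
  (rank_in : forall x, covered x -> (W (rank x) `\` Low (rank x)) x)
  (rank_uniq : forall v x, (W v `\` Low v) x -> rank x = v)
  (layer_covered : forall v x, (W v `\` Low v) x -> covered x)
  (rank_lt : forall v x, covered x -> ~ W v x -> lt v (rank x))
  (W_Low : forall v w, lt v w -> W v `<=` Low w).

Local Notation layer v := (W v `\` Low v).

(* A token is a source or an edge entering the layer of its head from below. *)
Definition valid (t : V + E) : Prop := covered (target t) /\
  match t with inl a => I a | inr e => Low (rank (ter e)) (init e) end.

Variable P : V + E -> seq E.
Hypothesis P_path : forall t, valid t ->
  [/\ chain (target t) (P t), uniq (target t :: map ter (P t)),
    ~ layer (rank (target t)) (walk_end (target t) (P t)) &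
    forall e, e \in P t ->
      layer (rank (target t)) (init e) /\ ~ Low (rank (target t)) (ter e)].

(** The token whose link carries the edge; arbitrary for edges on no link. *)
Variable tok : E -> V + E.
Hypothesis tokP : forall e t, valid t -> e \in P t -> tok e = t.

Definition used e := valid (tok e) /\ e \in P (tok e).

Definition height e := rank (target (tok e)).
Definition pos e := index e (P (tok e)).

Inductive on_trail (a : V) : V + E -> Prop :=
| on_trail_start : on_trail a (inl a)
| on_trail_next e : on_trail a (tok e) -> on_trail a (inr e).

Lemma on_trail_inj a a' t : on_trail a t -> on_trail a' t -> a = a'.
Proof.
by move=> ta; elim: ta a' => [|e _ IH] a' H; inversion H; [|exact: IH].
Qed.

Lemma used_in t e : valid t -> e \in P t -> used e.
Proof. by move=> vt et; rewrite /used (tokP vt et). Qed.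

Lemma used_layer e : used e -> layer (height e) (init e) /\ ~ Low (height e) (ter e).
Proof. by move=> [vt et]; have [_ _ _] := P_path vt; apply. Qed.

Lemma rank_init e : used e -> rank (init e) = height e.
Proof. by move=> /used_layer[/rank_uniq]. Qed.

Lemma init_inj_tok e f : used e -> used f -> tok e = tok f -> init e = init f ->
  e = f.
Proof.
move=> [ve ee] [_ fe] ef; rewrite -ef in fe; have [ch un _ _] := P_path ve.
move=> ief; rewrite -(nth_index e ee) -(nth_index e fe); congr nth.
have ui : uniq (map init (P (tok e))).
  by move: un; rewrite -chain_map_init // rcons_uniq => /andP[].
apply/eqP; rewrite -(nth_uniq (init e) _ _ ui) ?size_map ?index_mem //.
by rewrite !(nth_map e) ?index_mem // !nth_index // ief.
Qed.

(** Strict progress along a trail, to a higher layer or further along one link; it prevents repeated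
    vertices. *)
Definition before e f := lt (height e) (height f) \/
  (tok e = tok f /\ (pos e < pos f)%N).

Lemma before_trans e f g : before e f -> before f g -> before e g.
Proof.
rewrite /before /height => -[ef|[tef pef]] [fg|[tfg pfg]].
- by left; exact: lt_trans ef fg.
- by left; rewrite -tfg.
- by left; rewrite tef.
- by right; rewrite tef; split=> //; exact: ltn_trans pfg.
Qed.

Lemma before_init e f : used e -> used f -> before e f -> init e <> init f.
Proof.
move=> ue uf [hef ief|[tef pef] /(init_inj_tok ue uf tef) ef].
  by apply: (@lt_irr (height f)); rewrite -{1}(rank_init uf) -ief rank_init.
by rewrite ef ltnn in pef.
Qed.

(** The second alternative passes from the last edge [e] of a link to the link of [e] as a token of
    a higher layer. *)
Definition succ e f := [/\ used f, init f = ter e &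
  (tok f = tok e /\ pos f = (pos e).+1) \/
  [/\ tok f = inr e, lt (height e) (height f) & ~ W (height e) (ter e)]].

(** A link has an edge because it starts in its layer and ends outside. *)
Lemma P_first t : valid t -> exists2 e, e \in P t & init e = target t.
Proof.
move=> vt; have [ch _ nend _] := P_path vt; have [cov _] := vt.
case: (P t) ch nend => [|e es] /=; first by have := rank_in cov.
by move=> [ie _] _; exists e; rewrite ?mem_head.
Qed.

Lemma succ_exists e : used e -> covered (ter e) -> exists f, succ e f.
Proof.
move=> ue cov; have [vt et] := ue; have [ch un nend Pe] := P_path vt.
have uP : uniq (P (tok e)) by move: un => /= /andP[_ /map_uniq].
have pe : (pos e < size (P (tok e)))%N by rewrite index_mem.
have eE : nth e (P (tok e)) (pos e) = e by rewrite nth_index.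
have [last|notlast] := eqVneq (pos e).+1 (size (P (tok e))); last first.
  have lt_pos : ((pos e).+1 < size (P (tok e)))%N by rewrite ltn_neqAle notlast.
  pose f := nth e (P (tok e)) (pos e).+1.
  have fP : f \in P (tok e) by rewrite mem_nth.
  exists f; split; first exact: used_in fP.
    by rewrite (chain_nth e ch lt_pos) eE.
  by left; rewrite /pos (tokP vt fP) index_uniq.
have endE : walk_end (target (tok e)) (P (tok e)) = ter e.
  move: last eE; case/lastP: (P (tok e)) => [//|p x].
  by rewrite size_rcons => -[->]; rewrite nth_rcons ltnn eqxx /walk_end map_rcons last_rcons => ->.
(* The link ends outside its layer and not below it, so the head of [e] has higher rank and [e] is a
   valid token there. *)
have nW : ~ W (height e) (ter e).
  by move=> We; have [_ nLow] := Pe e et; apply: nend; rewrite endE.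
have h_lt := rank_lt cov nW.
have vn : valid (inr e).
  by split=> //=; apply: (W_Low h_lt); have [[]] := used_layer ue.
have [f fP fi] := P_first vn.
exists f; split=> //; first exact: used_in fP.
by right; split=> //; rewrite /height (tokP vn fP).
Qed.

Lemma succ_before e f : succ e f -> before e f.
Proof. by case=> _ _ [[tf pf]|[_ h _]]; [right; rewrite tf pf|left]. Qed.

Lemma succ_on_trail a e f : succ e f -> on_trail a (tok e) -> on_trail a (tok f).
Proof. by case=> _ _ [[-> _]|[-> _ _]] // ?; exact: on_trail_next. Qed.

Section Ray.
Variable s : nat -> E.
Hypotheses (s0 : used (s 0)) (s_succ : forall n, succ (s n) (s n.+1)).

Lemma ray_used n : used (s n).
Proof. by case: n => [//|n]; have [] := s_succ n. Qed.

Lemma ray_layer_change n : exists m,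
  [/\ W (height (s n)) (init (s m)), ~ W (height (s n)) (ter (s m)) &
    init (s m.+1) = ter (s m)].
Proof.
have : exists m, [/\ tok (s m) = tok (s n), ~ W (height (s m)) (ter (s m)) &
    init (s m.+1) = ter (s m)].
  apply: contrapT => none.
  (* On one link [pos] grows by one per step and would exceed the length of the link. *)
  have stay k : tok (s (n + k)) = tok (s n) /\ pos (s (n + k)) = (pos (s n) + k)%N.
    elim: k => [|k [tk pk]]; first by rewrite !addn0.
    have [_ si [[t1 p1]|[_ _ nW]]] := s_succ (n + k).
      by rewrite !addnS t1 p1 tk pk.
    by case: none; exists (n + k).
  have [tk pk] := stay (size (P (tok (s n)))).
  have [_] := ray_used (n + size (P (tok (s n)))).
  by rewrite -index_mem -/(pos _) pk tk ltnNge leq_addl.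
move=> [m [tm nW im]]; exists m; rewrite {1 2}/height -tm; split=> //.
by have [[]] := used_layer (ray_used m).
Qed.

Lemma ray_escapes X : cut X -> ~ (forall n, X (init (s n))).
Proof.
move=> cX sX.
have W_tot (m n : nat) : setT m -> setT n ->
    W (height (s m)) `<=` W (height (s n)) \/ W (height (s n)) `<=` W (height (s m)).
  by move=> _ _; exact: W_total.
pose U := \bigcup_(n in setT) W (height (s n)).
have gU : good U by apply: good_bigcup => //; exists 0.
have sU n : U (init (s n)).
  by exists n => //; have [[]] := used_layer (ray_used n).
have cXU := good_cutI gU cX; have [_ fXU] := cXU.
(* One stage contains the tails of all edges leaving the intersection of [X] and [U]. Above it
   nothing leaves, so by goodness nothing enters. *)
have [||n _ bn] := finite_sub_bigcup_chain (finite_image init fXU) _ W_tot.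
- by exists 0.
- by move=> _ [e [[_ Ui] _] <-].
have [fin le] := goodW (height (s n)) cXU.
have inc0 : incoming I (W (height (s n))) ((X `&` U) `\` W (height (s n))) = set0.
  apply: fset_set_set0 => //; apply/eqP; rewrite -cardfs_eq0 -leqn0.
  apply: leq_trans le _; rewrite (_ : outgoing _ _ = set0).
    by rewrite /ncard fset_set0 cardfs0.
  apply/seteqP; split=> e // Oe; have [[_ nWi] _] := Oe.
  by apply: nWi; apply: bn; exists e => //; exact: outgoing_boundary Oe.
(* The ray crosses out of that stage through [s m], a forbidden incoming edge. *)
have [m [Wm nWm im]] := ray_layer_change n.
suff : incoming I (W (height (s n))) ((X `&` U) `\` W (height (s n))) (inr (s m)).
  by rewrite inc0.
by split=> //=; rewrite -im in nWm *; do !split.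
Qed.

Lemma before_segment N m n : (forall k, (k < N)%N -> succ (s k) (s k.+1)) ->
  (m < n <= N)%N -> before (s m) (s n).
Proof.
move=> sN; elim: n => [|n IHn]; first by rewrite ltn0.
rewrite ltnS leq_eqVlt => /andP[/orP[/eqP ->|mn] nN].
  exact/succ_before/sN.
by apply: before_trans (IHn _) (succ_before (sN _ nN)); rewrite mn ltnW.
Qed.

End Ray.

Lemma segment_inits_uniq (s : nat -> E) N : used (s 0) ->
  (forall k, (k < N)%N -> succ (s k) (s k.+1)) ->
  forall m n, (m <= N)%N -> (n <= N)%N -> init (s m) = init (s n) -> m = n.
Proof.
move=> s0 sN.
have us k : (k <= N)%N -> used (s k) by case: k => [//|k] /sN[].
suff lt_ne m n : (m < n <= N)%N -> init (s m) <> init (s n).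
  move=> m n mN nN e; have [mn|nm|//] := ltngtP m n.
    by case: (lt_ne m n); rewrite ?mn.
  by case: (lt_ne n m); rewrite ?nm.
move=> /[dup] mnN /andP[mn nN]; apply: before_init; try apply: us => //.
- by apply: leq_trans nN; exact: ltnW.
- exact: before_segment mnN.
Qed.

Lemma uncovered_dominates x : ~ covered x -> x = b \/ vertex_dominates x b.
Proof.
move=> nc; have [|nb] := pselect (x = b); [by left|right].
have [|[X [cX xX]]|//] := @cut_or_disjoint_paths _ b [set x].
- by move=> bx; apply: nb.
- by case: nc; exists X => //; apply: xX.
Qed.

(** Follow [succ] from the first edge of the link of [a], up to the first uncovered head if there is
    one. Otherwise the trail is a ray, which no cut contains. *)
Lemma route a : I a -> exists q : path_or_ray G,
  [/\ start q = a, ends_at q b \/ dominates q b &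
    forall e, edges q e -> used e /\ on_trail a (tok e)].
Proof.
move=> Ia; have [cov|nc] := pselect (covered a); last first.
  by exists (IsPath (@walk_dipath G a [::] Logic.I isT)); split=> //; exact: uncovered_dominates.
have va : valid (inl a) by [].
have /choice[nxt nxtP] e : exists f, used e -> covered (ter e) -> succ e f.
  have [ue|] := pselect (used e); last by exists e.
  have [ce|] := pselect (covered (ter e)); last by exists e.
  by have [f ef] := succ_exists ue ce; exists f.
have [e0 e0P ie0] := P_first va.
pose s n := iter n nxt e0.
have us0 : used (s 0) by exact: used_in e0P.
have trail0 : on_trail a (tok (s 0)) by rewrite (tokP va e0P); exact: on_trail_start.
(* [nxt] is meaningful only while heads are covered, so the claim is limited to such initial
   segments. *)
have seg N : (forall k, (k < N)%N -> covered (ter (s k))) ->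
    (forall k, (k < N)%N -> succ (s k) (s k.+1)) /\
    forall k, (k <= N)%N -> used (s k) /\ on_trail a (tok (s k)).
  elim: N => [|N IHN] covN; first by split=> // k; rewrite leqn0 => /eqP ->.
  have [|sN uN] := IHN; first by move=> k kN; apply: covN; exact: ltnW.
  have [uN' tN'] := uN N (leqnn _).
  have sN' : succ (s N) (s N.+1) by apply: nxtP => //; apply: covN.
  split=> k; first by rewrite ltnS leq_eqVlt => /orP[/eqP ->|/sN].
  rewrite leq_eqVlt => /orP[/eqP ->|/uN //].
  by split; [case: sN'|exact: succ_on_trail sN' tN'].
have [[n0 ncov]|allcov] := pselect (exists n, ~ covered (ter (s n))).
  have exn : exists n, `[< ~ covered (ter (s n)) >] by exists n0; apply/asboolP.
  case: (ex_minnP exn) => n /asboolP ncn minn.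
  have covn k : (k < n)%N -> covered (ter (s k)).
    by move=> kn; apply: contrapT => /asboolP/minn; rewrite leqNgt kn.
  have [sn un] := seg n covn.
  have [|ch endE] := @mkseq_chain _ s n; first by move=> k /sn[_ ->].
  have uniqs : uniq (init (s 0) :: map ter (mkseq s n.+1)).
    (* The vertices are relisted as the tails, all covered, followed by the uncovered end. *)
    rewrite -chain_map_init // endE rcons_uniq; apply/andP; split.
      apply/negP => /mapP[e /mapP[k]]; rewrite mem_iota ltnS => /un[uk _] -> tE.
      by apply: ncn; rewrite tE; apply: layer_covered; exact: (used_layer uk).1.
    rewrite /mkseq -map_comp map_inj_in_uniq ?iota_uniq // => k l.
    rewrite !mem_iota !ltnS => kn ln.
    exact: segment_inits_uniq us0 sn k l kn ln.
  exists (IsPath (walk_dipath ch uniqs)); split.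
  - by rewrite /= ie0.
  - by rewrite /= /path_dominates /path_end -/(walk_end _ _) /= endE; exact: uncovered_dominates.
  - by move=> e /InP/mapP[k]; rewrite mem_iota ltnS => /un H ->.
have cov_s n : covered (ter (s n)) by apply: contrapT => ?; apply: allcov; exists n.
have s_succ n : succ (s n) (s n.+1) by have [+ _] := seg n.+1 (fun k _ => cov_s k); apply.
have inj : injective (fun n => init (s n)).
  move=> m n; apply: (@segment_inits_uniq s (maxn m n)) => //.
  - exact: leq_maxl.
  - exact: leq_maxr.
have s_ter n : ter (s n) = init (s n.+1) by have [_ ->] := s_succ n.
pose r := @DiRay G (fun n => init (s n)) s (fun=> erefl) s_ter inj.
exists (IsRay r); split=> //=; first last.
- by move=> e [n _ <-]; have [_] := seg n (fun k _ => cov_s k); apply.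
- right; have [|[X [cX rX]]|//] := @cut_or_disjoint_paths _ b (range (ray_vertex r)).
  (* Ray vertices are covered, whereas [b] lies in no cut. *)
  + move=> [n _ /= nb]; have [_ /(_ n (leqnn n))[un _]] := seg n (fun k _ => cov_s k).
    by have [X [nX _]] := layer_covered (used_layer un).1; rewrite nb.
  + by case: (@ray_escapes s us0 s_succ X cX) => n; apply: rX; exists n.
Qed.

End Routing.

(** * The two implications *)

Section Linkages.
Variables (G : digraph) (b : vertex G) (I : set (vertex G)).
Local Notation V := (vertex G).

Lemma good_domination_linkage : good b I set0 ->
  exists Q : V -> path_or_ray G, domination_linkage I b Q.
Proof.
move=> g0.
have [lt [Low [X [[wf lt_trans tri] [gL gW cX LowE covW]]]]] := layering g0.
pose W v := Low v `|` X v.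
have W_Low v w : lt v w -> W v `<=` Low w by move=> vw; rewrite LowE => x Wx; exists v.
have lt_irr x : ~ lt x x by elim/(well_founded_ind wf): x => x IH xx; exact: (IH x xx xx).
(* [rank x] is the least stage containing [x]: without one, induction shows that no stage contains
   [x]. *)
have /choice[rank rankP] x : exists v, covered b x -> W v x /\ ~ Low v x.
  have [cov|] := pselect (covered b x); last by exists x.
  apply: contrapT => none; suff: forall v, ~ W v x by move/(_ x); apply; exact: covW.
  elim/(well_founded_ind wf) => v IH Wx; apply: none; exists v => _; split=> //.
  by rewrite LowE => -[w wv]; exact: IH.
have rank_uniq v x : (W v `\` Low v) x -> rank x = v.
  move=> [Wx nL]; have [|Wr nLr] := rankP x.
    by case: Wx => // Xx; exists (X v).
  have [rv|//|vr] := tri (rank x) v.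
    by case: nL; exact: (W_Low _ _ rv).
  by case: nLr; exact: (W_Low _ _ vr).
have layer_covered v x : (W v `\` Low v) x -> covered b x.
  by move=> [[//|Xx] _]; exists (X v).
have rank_lt v x : covered b x -> ~ W v x -> lt v (rank x).
  move=> /rankP[Wr _] nW; have [//|vr|rv] := tri v (rank x).
    by rewrite vr in nW.
  by case: nW; left; exact: (W_Low _ _ rv).
have W_total v w : W v `<=` W w \/ W w `<=` W v.
  by have [vw|->|wv] := tri v w; [left|left|right] => // x /W_Low; left; auto.
have /choice[L LP] v := layer_linkage (gL v) (cX v).
pose P t := L (rank (target t)) t.
have layerE v : W v `\` Low v = X v `\` Low v.
  by apply/seteqP; split=> x [Wx nL]; split=> //; [case: Wx|right].
pose valid := valid b I Low rank.
have valid_in t : valid t ->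
    incoming I (Low (rank (target t))) (X (rank (target t)) `\` Low (rank (target t))) t.
  by case: t => [a|e] [cov tI]; split=> //; have := rankP _ cov; case=> -[].
have P_path t : valid t -> [/\ chain (target t) (P t), uniq (target t :: map ter (P t)),
    ~ (W (rank (target t)) `\` Low (rank (target t))) (walk_end (target t) (P t)) &
    forall e, e \in P t -> (W (rank (target t)) `\` Low (rank (target t))) (init e) /\
      ~ Low (rank (target t)) (ter e)].
  by move=> /valid_in vt; rewrite layerE; have [+ _] := LP (rank (target t)); apply.
(* The tail of a shared edge determines the layer, so both tokens belong to one layer, whose links
   are disjoint. *)
have P_disj t t' e : valid t -> valid t' -> e \in P t -> e \in P t' -> t = t'.
  move=> vt vt' et et'.
  have [_ _ _ /(_ e et)[/rank_uniq rt _]] := P_path t vt.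
  have [_ _ _ /(_ e et')[/rank_uniq rt' _]] := P_path t' vt'.
  have [_ tL] := LP (rank (target t)); apply: tL; first exact: valid_in.
    by rewrite -rt rt'; exact: valid_in.
  by exists e; split=> //=; rewrite -rt rt'.
have /choice[tok tokP] e : exists t, forall t', valid t' -> e \in P t' -> t = t'.
  have [[t [vt et]]|none] := pselect (exists t, valid t /\ e \in P t).
    by exists t => t' vt'; exact: P_disj vt vt' et.
  by exists (inr e) => t' vt' et'; case: none; exists t'.
have tokP' e t : valid t -> e \in P t -> tok e = t by exact: tokP.
have R a := route lt_irr lt_trans gW W_total rankP rank_uniq layer_covered
  rank_lt W_Low P_path tokP' (a := a).
have /choice[Q QP] a : exists q : path_or_ray G, I a -> [/\ start q = a,
    ends_at q b \/ dominates q b & forall e, edges q e -> on_trail tok a (tok e)].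
  have [Ia|] := pselect (I a); last first.
    by exists (IsPath (@walk_dipath G a [::] Logic.I isT)).
  by have [q [sq dq tq]] := R a Ia; exists q => _; split=> // e /tq[].
exists Q; split=> [a a' Ia Ia' [e [ea ea']]|a /QP[]//].
have [_ _ /(_ e ea) ta] := QP a Ia; have [_ _ /(_ e ea') ta'] := QP a' Ia'.
exact: on_trail_inj ta ta'.
Qed.

(** If [q] stayed in [X], it would not end at [b], and infinitely many disjoint paths to [b] would
    start in a cut. *)
Lemma domination_crosses (q : path_or_ray G) (X : set V) : cut b X -> X (start q) ->
  ends_at q b \/ dominates q b -> exists e, edges q e /\ boundary X e.
Proof.
move=> cX; have [nXb _] := cX; case: q => [p|r] /= Xs dom.
  apply: dipath_crosses => // Xe; case: dom => [pb|]; first by rewrite pb in Xe.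
  by apply: (cut_no_disjoint_paths cX) => _ ->.
case: dom => // dom; apply: contrapT => none.
apply: (cut_no_disjoint_paths cX _ dom) => _ [n _ <-].
elim: n => [//|n IHn]; apply: contrapT => nX; apply: none.
by exists (ray_edge r n); split; [exists n|split; rewrite ?ray_init ?ray_ter].
Qed.

Lemma domination_linkage_finite (Q : V -> path_or_ray G) (S : set V) :
  I `<=` ~` [set b] -> domination_linkage I b Q -> S `<=` I -> finite_set S ->
  has_linkage S b.
Proof.
move=> Ib [tQ Qdom] SI /finite_seqP[s0 SE]; pose s := undup s0.
have sP a : a \in s <-> S a by rewrite mem_undup SE.
have [|||P [Pw Pd]] := @menger G _ (fun v => v != b) (fun e => init e != b) s id.
- by [].
- exact: undup_uniq.
(* Here [b] is the only sink. A finite [L] makes [R] a cut, and the members of [Q] starting in [R]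
   cross its boundary in distinct edges. *)
- move=> R L RY RL; pose X : set V := [set` R].
  have bL : boundary X `<=` [set` L].
    by move=> e [Xi /negP Xt]; apply: RL => //; exact: RY.
  have cX : cut b X.
    by split; [move=> /RY; rewrite /in_mem /= eqxx|exact: sub_finite_set bL _].
  have [_ fX] := cX.
  have [] := @ncard_transversal _ _ (S `&` X) (fun a => edges (Q a)) _ fX.
  + by apply: sub_trivIset tQ => a [/SI].
  + move=> a [/SI/Qdom[sa da] Xa].
    by apply: domination_crosses => //; rewrite sa.
  + move=> _ le; rewrite -size_filter -(@ncard_uniq _ (S `&` X)).
    * exact: leq_trans le (ncard_le_size bL).
    * by rewrite filter_uniq ?undup_uniq.
    * move=> a; rewrite mem_filter; split; first by move=> /andP[Ra /sP].
      by move=> [/sP sa Ra]; apply/andP; split.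
have /choice[D DP] a : exists p : dipath G, S a ->
    [/\ path_start p = a, path_end p = b & path_seq p = P a].
  have [/sP sa|] := pselect (S a); last first.
    by exists (@walk_dipath G a [::] Logic.I isT).
  have [ch un end_b _] := Pw a sa; exists (walk_dipath ch un) => _; split=> //.
  by move/negPn: end_b => /eqP.
exists D; split=> [a a' Sa Sa' [e [/InP ea /InP ea']]|a /DP[]//].
move: ea ea'; have [_ _ ->] := DP a Sa; have [_ _ ->] := DP a' Sa'.
move=> ea ea'; apply: contrapT => /eqP aa'.
by have := Pd a a' (iffRL (sP a) Sa) (iffRL (sP a') Sa') aa' e ea; rewrite ea'.
Qed.

End Linkages.

Theorem theorem2p1 (G : digraph) (b : vertex G) (I : set (vertex G))
    (hI : I `<=` ~` [set b]) :
  (exists Q : vertex G -> path_or_ray G, domination_linkage I b Q) <->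
  (forall S : set (vertex G), S `<=` I -> finite_set S -> has_linkage S b).
Proof.
split=> [[Q dQ] S|link]; first exact: domination_linkage_finite hI dQ.
exact/good_domination_linkage/good0.
Qed.
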